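(* Let $\mathcal K$ be a complete idempotent semiring, let $(Y,X)$ be a predual pair with bracket $\langle\cdot\mid\cdot\rangle:Y\times X\to Z$, where $Z$ is a complete $\mathcal K$-bisemimodule, and let $\varphi\in Z$. Then the map $x\mapsto{}^-x$ is an anti-isomorphism of complete lattices $\overline X\to\overline Y$, with inverse $y\mapsto y^-$.
   Context: A semiring $(\mathcal K,\oplus,\otimes,\varepsilon,e)$ is idempotent if $a\oplus a=a$ for all $a$. An idempotent commutative monoid carries the natural order $a\le b\iff a\oplus b=b$. An ordered set is complete if every subset $U$ has a least upper bound $\bigvee U$ (it is then a complete lattice). A map $f$ between complete ordered sets is continuous if $f(\bigvee U)=\bigvee f(U)$ for every subset $U$ (including $U=\varnothing$). An idempotent semiring is complete if it is complete for its natural order and all its left and right multiplications are continuous. A right $\mathcal K$-semimodule is a commutative monoid $(X,\oplus,\varepsilon)$ with a right action satisfying $x(\lambda\mu)=(x\lambda)\mu$, $(x\oplus y)\lambda=x\lambda\oplus y\lambda$, $x(\lambda\oplus\mu)=x\lambda\oplus x\mu$, $x\varepsilon=\varepsilon$, $xe=x$; its addition is then idempotent. It is complete if it is complete for its natural order and the maps $x\mapsto x\lambda$ on $X$ and $\mu\mapsto v\mu$ from $\mathcal K$ to $X$ are all continuous. (Complete) left semimodules are defined dually; a (complete) bisemimodule has left and right (complete) semimodule structures, over the same additive monoid, whose actions commute. A map is linear if it preserves finite sums and commutes with the action. A predual pair $(Y,X)$ consists of a complete right $\mathcal K$-semimodule $X$, a complete left $\mathcal K$-semimodule $Y$, and a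 bracket $\langle\cdot\mid\cdot\rangle:Y\times X\to Z$ into a complete $\mathcal K$-bisemimodule $Z$ such that for all $x\in X$ the map $Y\to Z$, $y\mapsto\langle y\mid x\rangle$ is left linear and continuous, and for all $y\in Y$ the map $X\to Z$, $x\mapsto\langle y\mid x\rangle$ is right linear and continuous. For $\varphi\in Z$: ${}^-x=\max\{y\in Y\mid\langle y\mid x\rangle\le\varphi\}$ for $x\in X$, and $y^-=\max\{x\in X\mid\langle y\mid x\rangle\le\varphi\}$ for $y\in Y$. The sets of closed elements are $\overline X=\{y^-\mid y\in Y\}$ and $\overline Y=\{{}^-x\mid x\in X\}$, with the orders induced from $X$ and $Y$; they are complete lattices (stable under arbitrary infima of $X$, resp. $Y$, but their suprema need not coincide with those of $X$ and $Y$). For complete lattices $S,T$, an anti-isomorphism $f:S\to T$ is a bijection such that $f(\bigvee U)=\bigwedge f(U)$ and $f(\bigwedge U)=\bigvee f(U)$ for all $U\subset S$. *)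

(* Defs.v *)
From HB Require Import structures.
From mathcomp Require Import all_boot all_order all_algebra.
From mathcomp Require Import boolp classical_sets functions.

Set Implicit Arguments.
Unset Strict Implicit.
Unset Printing Implicit Defensive.

Import Order.TTheory GRing.Theory.
Local Open Scope classical_set_scope.
Local Open Scope ring_scope.

HB.mixin Record Nmodule_isIdempotent V of GRing.Nmodule V := {
  addrii : @idempotent_op V +%R
}.

#[short(type="idemNmodType")]
HB.structure Definition IdemNmodule :=
  { V of GRing.Nmodule V & Nmodule_isIdempotent V }.

Fact natural_display : Order.disp_t. Proof. exact: Order.Disp tt tt. Qed.

(* Copy of [V] carrying the natural order. The order cannot be put on [V]
   itself: MathComp has no common ancestor of such a structure and of
   [porderZmodType]. *)
Definition natord (V : idemNmodType) : Type := V.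

Section NaturalOrder.
Variable V : idemNmodType.

HB.instance Definition _ := Choice.on (natord V).

Definition natle (x y : natord V) : bool := (x : V) + y == y.

Lemma natle_refl : reflexive natle.
Proof. by move=> x; apply/eqP/addrii. Qed.

Lemma natle_anti : antisymmetric natle.
Proof. by move=> x y /andP[/eqP xy /eqP yx]; rewrite -xy -{1}yx addrC. Qed.

Lemma natle_trans : transitive natle.
Proof.
move=> y x z /eqP xy /eqP yz; apply/eqP.
by rewrite -yz addrA xy.
Qed.

HB.instance Definition _ := Order.Le_isPOrder.Build natural_display (natord V)
  natle_refl natle_anti natle_trans.

End NaturalOrder.

(* [U] ranges over all subsets, including [set0]. *)
HB.mixin Record IdemNmodule_isComplete V of IdemNmodule V := {
  ex_isLub : forall U : set (natord V), exists s : natord V, isLub U s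
}.

#[short(type="completeNmodType")]
HB.structure Definition CompleteNmodule :=
  { V of IdemNmodule V & IdemNmodule_isComplete V }.

(* Between complete ordered sets this is [f (sup U) = sup (f @` U)] for every
   subset [U], including [set0]. *)
Definition sup_continuous (S T : completeNmodType) (f : S -> T) : Prop :=
  forall (U : set (natord S)) (s : natord S),
    isLub U s -> isLub ((f : natord S -> natord T) @` U) (f s).

HB.mixin Record PzSemiRing_isContinuous K
    of GRing.PzSemiRing K & CompleteNmodule K := {
  mull_continuous : forall a : K, sup_continuous (fun x : K => a * x);
  mulr_continuous : forall a : K, sup_continuous (fun x : K => x * a)
}.

#[short(type="completeSemiRingType")]
HB.structure Definition CompleteSemiRing :=
  { K of GRing.PzSemiRing K & CompleteNmodule K & PzSemiRing_isContinuous K }.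

(* Right semimodules have an action of their own, instead of being left
   semimodules over [K^c], so that one carrier can bear both structures. *)
HB.mixin Record Nmodule_isRSemiModule (K : pzSemiRingType) V
    of GRing.Nmodule V := {
  rscale : V -> K -> V;
  rscalerA : forall x a b, rscale x (a * b) = rscale (rscale x a) b;
  rscalerDl : forall x y a, rscale (x + y) a = rscale x a + rscale y a;
  rscalerDr : forall x a b, rscale x (a + b) = rscale x a + rscale x b;
  rscaler0 : forall x, rscale x 0 = 0;
  rscaler1 : forall x, rscale x 1 = x
}.

#[short(type="rSemiModType")]
HB.structure Definition RSemiModule (K : pzSemiRingType) :=
  { V of GRing.Nmodule V & Nmodule_isRSemiModule K V }.

HB.mixin Record LSemiModule_isContinuous (K : completeSemiRingType) V
    of GRing.LSemiModule K V & CompleteNmodule V := {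
  scale_continuous : forall a : K, sup_continuous (fun y : V => a *: y);
  scale_continuous_scalar :
    forall y : V, sup_continuous (fun a : K => a *: y)
}.

#[short(type="completeLSemiModType")]
HB.structure Definition CompleteLSemiModule (K : completeSemiRingType) :=
  { V of GRing.LSemiModule K V & CompleteNmodule V
       & LSemiModule_isContinuous K V }.

HB.mixin Record RSemiModule_isContinuous (K : completeSemiRingType) V
    of RSemiModule K V & CompleteNmodule V := {
  rscale_continuous : forall a : K, sup_continuous (fun x : V => rscale x a);
  rscale_continuous_scalar :
    forall x : V, sup_continuous (fun a : K => rscale x a)
}.

#[short(type="completeRSemiModType")]
HB.structure Definition CompleteRSemiModule (K : completeSemiRingType) :=
  { V of RSemiModule K V & CompleteNmodule V & RSemiModule_isContinuous K V }.

HB.mixin Record LRSemiModule_isBiSemiModule (K : completeSemiRingType) V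
    of GRing.LSemiModule K V & RSemiModule K V := {
  scale_rscaleA : forall (a b : K) (z : V),
    rscale (a *: z) b = a *: rscale z b
}.

#[short(type="completeBiSemiModType")]
HB.structure Definition CompleteBiSemiModule (K : completeSemiRingType) :=
  { V of CompleteLSemiModule K V & CompleteRSemiModule K V
       & LRSemiModule_isBiSemiModule K V }.

Definition left_linear (K : completeSemiRingType)
    (V W : completeLSemiModType K) (f : V -> W) : Prop :=
  nmod_morphism f /\ forall (a : K) (v : V), f (a *: v) = a *: f v.

Definition right_linear (K : completeSemiRingType)
    (V W : completeRSemiModType K) (f : V -> W) : Prop :=
  nmod_morphism f /\ forall (v : V) (a : K), f (rscale v a) = rscale (f v) a.

Record predualPair (K : completeSemiRingType) (Y : completeLSemiModType K)
    (X : completeRSemiModType K) (Z : completeBiSemiModType K) := PredualPair {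
  bracket :> Y -> X -> Z;
  bracket_linear_l : forall x : X, left_linear (fun y : Y => bracket y x);
  bracket_continuous_l : forall x : X, sup_continuous (fun y : Y => bracket y x);
  bracket_linear_r : forall y : Y, right_linear (fun x : X => bracket y x);
  bracket_continuous_r : forall y : Y, sup_continuous (fun x : X => bracket y x)
}.

Section Extrema.
Context {d : Order.disp_t} {T : porderType d}.

Definition greatest (A : set T) (m : T) : Prop := A m /\ ubound A m.
Definition least (A : set T) (m : T) : Prop := A m /\ lbound A m.

(* Suprema and infima computed inside the subset [S], with the induced order;
   they may differ from those of the ambient type. *)
Definition lub_in (S U : set T) (m : T) : Prop := least (S `&` ubound U) m.
Definition glb_in (S U : set T) (m : T) : Prop := greatest (S `&` lbound U) m.

Definition complete_lattice_on (S : set T) : Prop :=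
  forall U : set T, U `<=` S ->
    (exists m, lub_in S U m) /\ (exists m, glb_in S U m).

End Extrema.

Definition anti_isomorphism {d d' : Order.disp_t}
    {T : porderType d} {T' : porderType d'}
    (S : set T) (S' : set T') (f : T -> T') : Prop :=
  [/\ complete_lattice_on S, complete_lattice_on S', set_bij S S' f,
      forall (U : set T) (m : T), U `<=` S ->
        lub_in S U m -> glb_in S' (f @` U) (f m)
    & forall (U : set T) (m : T), U `<=` S ->
        glb_in S U m -> lub_in S' (f @` U) (f m)].

Section Polars.
Variables (K : completeSemiRingType) (Y : completeLSemiModType K).
Variables (X : completeRSemiModType K) (Z : completeBiSemiModType K).
Variables (B : predualPair Y X Z) (phi : Z).

Definition below (y : natord Y) (x : natord X) : Prop :=
  ((B y x : natord Z) <= phi)%O.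

(* The default value [0] of [xget] is never used: see [lpolarP], [rpolarP]. *)
Definition lpolar (x : natord X) : natord Y :=
  xget (0 : Y) (greatest [set y : natord Y | below y x]).
Definition rpolar (y : natord Y) : natord X :=
  xget (0 : X) (greatest [set x : natord X | below y x]).

Definition closedX : set (natord X) := range rpolar.
Definition closedY : set (natord Y) := range lpolar.

End Polars.

Lemma greatest_sublevel (S T : completeNmodType) (f : S -> T) (phi : natord T) :
  sup_continuous f ->
  exists m, greatest [set s : natord S | ((f s : natord T) <= phi)%O] m.
Proof.
move=> fc; have [m [ubm lem]] :=
  ex_isLub [set s : natord S | ((f s : natord T) <= phi)%O].
exists m; split=> //=.
have [_] := fc _ _ (conj ubm lem); apply.
by move=> _ [s /= fs <-].
Qed.

Lemma lpolarP (K : completeSemiRingType) (Y : completeLSemiModType K)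
    (X : completeRSemiModType K) (Z : completeBiSemiModType K)
    (B : predualPair Y X Z) (phi : Z) (x : natord X) :
  greatest [set y : natord Y | below B phi y x] (lpolar B phi x).
Proof.
apply: xgetPex.
exact: (@greatest_sublevel Y Z _ _ (@bracket_continuous_l _ _ _ _ B x)).
Qed.

Lemma rpolarP (K : completeSemiRingType) (Y : completeLSemiModType K)
    (X : completeRSemiModType K) (Z : completeBiSemiModType K)
    (B : predualPair Y X Z) (phi : Z) (y : natord Y) :
  greatest [set x : natord X | below B phi y x] (rpolar B phi y).
Proof.
apply: xgetPex.
exact: (@greatest_sublevel X Z _ _ (@bracket_continuous_r _ _ _ _ B y)).
Qed.

(* Main.v *)
(* The polars form an antitone Galois connection: [y <= lpolar x] and
   [x <= rpolar y] both say that the bracket of [y] and [x] is at most [phi].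
   The composites of the two polars are then closure operators whose fixed
   points are the closed elements, and the supremum of a set of closed elements
   is the closure of its supremum in the ambient lattice. *)
Require Import Defs.
From mathcomp Require Import all_boot all_order all_algebra.
From mathcomp Require Import boolp classical_sets functions.

Local Open Scope classical_set_scope.
Local Open Scope ring_scope.

Import Order.TTheory GRing.Theory.

(** An equality of booleans, so that [rewrite] transposes inequalities in either direction; that [l]
    and [r] reverse the order follows from it. *)
Definition antitone_galois {d d' : Order.disp_t}
    {T : porderType d} {T' : porderType d'}
    (l : T -> T') (r : T' -> T) : Prop :=
  forall x y, (y <= l x)%O = (x <= r y)%O.

Lemma antitone_galois_sym {d d' : Order.disp_t}
    {T : porderType d} {T' : porderType d'} {l : T -> T'} {r : T' -> T} :
  antitone_galois l r -> antitone_galois r l.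
Proof. by move=> lr x y; rewrite lr. Qed.

Section AntitoneGalois.
Context {d d' : Order.disp_t} {T : porderType d} {T' : porderType d'}.
Context {l : T -> T'} {r : T' -> T}.
Hypothesis lr : antitone_galois l r.

Lemma galois_le_closure x : (x <= r (l x))%O.
Proof. by rewrite -lr. Qed.

Lemma galois_anti {x x'} : (x <= x')%O -> (l x' <= l x)%O.
Proof. by move=> xx'; rewrite lr (le_trans xx')// galois_le_closure. Qed.

End AntitoneGalois.

Section ClosedElements.
Context {d d' : Order.disp_t} {T : porderType d} {T' : porderType d'}.
Context {l : T -> T'} {r : T' -> T}.
Hypothesis lr : antitone_galois l r.
Let rl := antitone_galois_sym lr.

(** For [x = r y], applying the antitone [r] to [y <= l (r y)] gives the inequality that closure
    does not give. *)
Lemma galois_closed {x} : range r x -> r (l x) = x.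
Proof.
move=> [y _ <-]; apply/le_anti/andP; split; last exact: galois_le_closure lr _.
exact/(galois_anti rl)/(galois_le_closure rl).
Qed.

Lemma closed_complete_lattice :
  (forall U : set T, exists s, isLub U s) -> complete_lattice_on (range r).
Proof.
move=> lubT U US; split.
  have [s [ubs les]] := lubT U; exists (r (l s)); split.
    split=> [|u /ubs us]; first by exists (l s).
    exact/(le_trans us)/(galois_le_closure lr).
  move=> t [tS /les st]; rewrite -(galois_closed tS).
  exact/(galois_anti rl)/(galois_anti lr).
(* The infimum is the ambient one, built as the supremum of the lower bounds. It is closed because
   its closure is again a lower bound of [U], each [u] in [U] being its own closure. *)
have [g [ubg leg]] := lubT (lbound U).
have gU : lbound U g by move=> u uU; apply: leg => t; exact.
exists g; split; last by move=> t [_ /ubg].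
split=> //; exists (l g) => //.
apply/le_anti/andP; split; last exact: galois_le_closure lr _.
apply: ubg => u uU; rewrite -(galois_closed (US _ uU)).
by apply/(galois_anti rl)/(galois_anti lr)/gU.
Qed.

End ClosedElements.

Lemma closed_anti_isomorphism {d d' : Order.disp_t}
    {T : porderType d} {T' : porderType d'} (l : T -> T') (r : T' -> T) :
  (forall U : set T, exists s, isLub U s) ->
  (forall U : set T', exists s, isLub U s) ->
  antitone_galois l r -> anti_isomorphism (range r) (range l) l.
Proof.
move=> lubT lubT' lr; have rl := antitone_galois_sym lr.
split; first exact: closed_complete_lattice lr lubT.
- exact: closed_complete_lattice rl lubT'.
- split.
  + by move=> x _; exists x.
  + move=> x x' /set_mem xS /set_mem x'S lxx'.
    by rewrite -(galois_closed lr xS) lxx' galois_closed.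
  + by move=> y yS; exists (r y); [exists y | exact: (galois_closed rl yS)].
- move=> U m US [[mS ubm] lem]; split.
    split=> [|_ [u uU <-]]; first by exists m.
    exact/(galois_anti lr)/ubm.
  (* Transposition turns a lower bound [y] of the image into a closed upper bound [r y] of [U]. *)
  move=> y [yS lby]; rewrite lr; apply: lem; split; first by exists y.
  by move=> u uU; rewrite -lr; apply: lby; exists u.
- move=> U m US [[mS lbm] gem]; split.
    split=> [|_ [u uU <-]]; first by exists m.
    exact/(galois_anti lr)/lbm.
  (* The connection does not transpose [l m <= y], so [y] is written as [l (r y)]; it remains to see
     that [r y] is a lower bound of [U], whose elements are closed. *)
  move=> y [yS uby]; rewrite -(galois_closed rl yS); apply: (galois_anti lr).
  apply: gem; split=> [|u uU]; first by exists y.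
  rewrite -(galois_closed lr (US _ uU)); apply: (galois_anti rl).
  by apply: uby; exists u.
Qed.

(** Continuity is applied to the pair [[set s; t]], whose supremum is [t] when [s <= t]. *)
Lemma sup_continuous_le {S T : completeNmodType} {f : S -> T}
    {s t : natord S} :
  sup_continuous f -> (s <= t)%O -> ((f s : natord T) <= (f t : natord T))%O.
Proof.
move=> fc st; have tlub : isLub [set s; t] t.
  by split=> [u [] -> //|u]; apply; right.
by have [ub _] := fc _ _ tlub; apply: ub; exists s => //; left.
Qed.

Section PolarGalois.
Context {K : completeSemiRingType} {Y : completeLSemiModType K}.
Context {X : completeRSemiModType K} {Z : completeBiSemiModType K}.
Variables (B : predualPair Y X Z) (phi : Z).

(** The bracket is monotone in [y], so the elements satisfying [below] form a down-set, and [lpolar]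
    is its greatest element. *)
Lemma le_lpolar (x : natord X) (y : natord Y) :
  (y <= lpolar B phi x)%O <-> below B phi y x.
Proof.
have [mx ubx] := lpolarP B phi x; split=> [yx|]; last exact: ubx.
by apply: le_trans mx; exact: sup_continuous_le (bracket_continuous_l B x) yx.
Qed.

Lemma le_rpolar (x : natord X) (y : natord Y) :
  (x <= rpolar B phi y)%O <-> below B phi y x.
Proof.
have [my uby] := rpolarP B phi y; split=> [xy|]; last exact: uby.
by apply: le_trans my; exact: sup_continuous_le (bracket_continuous_r B y) xy.
Qed.

Lemma polar_galois : antitone_galois (lpolar B phi) (rpolar B phi).
Proof.
by move=> x y; apply/idP/idP => [/le_lpolar/le_rpolar|/le_rpolar/le_lpolar].
Qed.

End PolarGalois.

Theorem proposition26 (K : completeSemiRingType) (Y : completeLSemiModType K)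
    (X : completeRSemiModType K) (Z : completeBiSemiModType K)
    (B : predualPair Y X Z) (phi : Z) :
  [/\ anti_isomorphism (closedX B phi) (closedY B phi) (lpolar B phi),
      set_fun (closedY B phi) (closedX B phi) (rpolar B phi),
      forall x, closedX B phi x -> rpolar B phi (lpolar B phi x) = x
    & forall y, closedY B phi y -> lpolar B phi (rpolar B phi y) = y].
Proof.
have lr := polar_galois B phi; split.
- exact: closed_anti_isomorphism (@ex_isLub X) (@ex_isLub Y) lr.
- by move=> y _; exists y.
- by move=> x; exact: (galois_closed lr).
- by move=> y; exact: (galois_closed (antitone_galois_sym lr)).
Qed.
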